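(* Let $\mathcal{T}=\{T_1,T_2,\dots,T_k\}$ ($k\ge 1$) be a family of trees, which are different from paths, defined on a common vertex set $V$, and let $S_{\mathcal{I}}=\bigcap_{i=1}^{k}\mathcal{I}(T_i)$ be the set of vertices that are simultaneously interior vertices of every tree $T_i\in\mathcal{T}$. Then $$\operatorname{Sd}(\mathcal{T})\le |V|-|S_{\mathcal{I}}|-1.$$
   Context: All graphs are finite and simple. For a connected graph $G=(V,E)$, $d_G(x,y)$ denotes the length of a shortest path between $x$ and $y$ in $G$. A vertex $v$ resolves two vertices $x,y$ if $d_G(v,x)\ne d_G(v,y)$. A set $S\subseteq V$ is a metric generator for $G$ if every pair of distinct vertices of $G$ is resolved by some element of $S$. For a finite family $\mathcal{G}$ of connected graphs on a common vertex set $V$, a simultaneous metric generator for $\mathcal{G}$ is a set $S\subseteq V$ that is a metric generator for every graph in $\mathcal{G}$; the simultaneous metric dimension $\operatorname{Sd}(\mathcal{G})$ is the minimum cardinality of a simultaneous metric generator for $\mathcal{G}$. An interior vertex of a graph $G$ is a vertex of degree at least 2; $\mathcal{I}(G)$ denotes the set of interior vertices of $G$. ''Different from paths'' means that no $T_i$ is isomorphic to a path graph. *)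

(* Defs.v *)
From mathcomp Require Import all_boot.

Set Implicit Arguments.
Unset Strict Implicit.
Unset Printing Implicit Defensive.

Record sgraph (V : finType) := SGraph {
  adj : rel V;
  adj_sym : symmetric adj;
  adj_irrefl : irreflexive adj
}.

Definition graph_iso (V W : finType) (G : sgraph V) (H : sgraph W) : Prop :=
  exists2 f : V -> W, bijective f & forall x y, adj H (f x) (f y) = adj G x y.

Definition connected_graph (V : finType) (G : sgraph V) : Prop :=
  0 < #|V| /\ forall x y : V, connect (adj G) x y.

(* [ucycle] accepts sequences of length 2 (an edge run back and forth), hence
   the bound 3. *)
Definition acyclic_graph (V : finType) (G : sgraph V) : Prop :=
  forall c : seq V, ucycle (adj G) c -> size c < 3.

Definition is_tree (V : finType) (G : sgraph V) : Prop :=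
  connected_graph G /\ acyclic_graph G.

Definition path_adj (n : nat) : rel 'I_n :=
  fun i j => (i.+1 == j :> nat) || (j.+1 == i :> nat).

Lemma path_adj_sym n : symmetric (@path_adj n).
Proof. by move=> i j; rewrite /path_adj orbC. Qed.

Lemma path_adj_irrefl n : irreflexive (@path_adj n).
Proof. by move=> i; rewrite /path_adj orbb eqn_leq ltnn. Qed.

Definition path_graph (n : nat) : sgraph 'I_n :=
  SGraph (@path_adj_sym n) (@path_adj_irrefl n).

Definition is_path_graph (V : finType) (G : sgraph V) : Prop :=
  exists n : nat, graph_iso G (path_graph n).

Definition has_path (V : finType) (G : sgraph V) (x y : V) (n : nat) : bool :=
  [exists p : n.-tuple V,
     [&& path (adj G) x p, last x p == y & uniq (x :: p)]].

(* A path has at most #|V| - 1 edges; the value #|V| is taken exactly when x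
   and y are not connected. *)
Definition dist (V : finType) (G : sgraph V) (x y : V) : nat :=
  find (has_path G x y) (iota 0 #|V|).

Definition resolves (V : finType) (G : sgraph V) (v x y : V) : bool :=
  dist G v x != dist G v y.

Definition metric_generator (V : finType) (G : sgraph V) (S : {set V}) : bool :=
  [forall x : V, forall y : V, (x != y) ==> [exists v in S, resolves G v x y]].

Definition sim_metric_generator (V : finType) (k : nat) (G : 'I_k -> sgraph V)
    (S : {set V}) : bool :=
  [forall i : 'I_k, metric_generator (G i) S].

Lemma dist_self (V : finType) (G : sgraph V) (x : V) : dist G x x = 0.
Proof.
rewrite /dist; case: #|V| => [|m] //=; case: ifPn => // /existsP[].
by exists [tuple]; rewrite /= eqxx.
Qed.

Lemma dist_gt0 (V : finType) (G : sgraph V) (x y : V) :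
  x != y -> 0 < dist G x y.
Proof.
move=> xy; have V0 : 0 < #|V| by apply/card_gt0P; exists x.
rewrite /dist -(prednK V0) /=; case: ifP => // /existsP[p].
by rewrite tuple0 /= (negPf xy).
Qed.

(* The whole vertex set is a simultaneous metric generator, so the minimum
   defining Sd ranges over a nonempty collection. *)
Lemma sim_metric_generatorT (V : finType) (k : nat) (G : 'I_k -> sgraph V) :
  sim_metric_generator G [set: V].
Proof.
apply/forallP=> i; apply/forallP=> x; apply/forallP=> y; apply/implyP=> xy.
apply/existsP; exists x; rewrite inE /resolves dist_self eq_sym -lt0n.
exact: dist_gt0.
Qed.

Definition Sd (V : finType) (k : nat) (G : 'I_k -> sgraph V) : nat :=
  #|[arg min_(S < [set: V] | sim_metric_generator G S) #|S|]|.

Definition degree (V : finType) (G : sgraph V) (v : V) : nat :=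
  #|[set w | adj G v w]|.

Definition interior (V : finType) (G : sgraph V) : {set V} :=
  [set v | 2 <= degree G v].

(* Main.v *)
Require Import Defs.
From mathcomp Require Import all_boot all_algebra.

(** Say that a vertex is an end of a tree when it is not interior.  Any two
distinct vertices [x], [y] of a tree lie on a path joining two ends: prolong
the path from [y] to [x] beyond [x] as far as possible, reaching an end [w]
with [d(w,y) = d(w,x) + d(x,y)], and likewise beyond [y].  Each of these two
ends resolves [x] and [y], and they are distinct, since one is closer to [x] and
the other closer to [y].  So the ends of a tree, with any one vertex deleted,
still form a metric generator ([metric_generator_ends]).

Every end of every [T i] lies outside the set [I] of common interior vertices.
Deleting a single vertex [v] from the complement of [I] therefore deletes at
most one end of each tree, and leaves a simultaneous metric generator of
cardinality [|V| - |I| - 1].  Such a [v] exists because a tree has an end.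

The only use of acyclicity is [interior_has_farther_neighbor]: from an interior
vertex one can always step away from a given vertex [y].  This makes a
prolongation of maximal length stop at an end. *)

Set Implicit Arguments.
Unset Strict Implicit.
Unset Printing Implicit Defensive.

Import Num.Theory.

Section Distance.

Variables (V : finType) (G : sgraph V).

(** A walk may repeat vertices, whereas [dist] only measures repetition-free
paths; shortcutting the loops of the walk gives one that is no longer. *)
Lemma dist_leq_walk (x y : V) (p : seq V) :
  path (adj G) x p -> last x p = y -> dist G x y <= size p.
Proof.
move=> xp yE; move: yE; case/shortenP: xp => q xq uq sqp yE.
have szq : size q <= size p.
  by apply: uniq_leq_size => //; case/andP: uq.
apply: leq_trans szq; rewrite leqNgt; apply/negP => lt_qd.
have ltqV : size q < #|V|.
  by rewrite -[(size q).+1]/(size (x :: q)) -(card_uniqP uq) max_card.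
have := before_find 0 lt_qd; rewrite nth_iota // add0n => /negbT/negP; apply.
by apply/existsP; exists (in_tuple q); rewrite /= xq yE eqxx.
Qed.

Hypothesis G_conn : forall x y : V, connect (adj G) x y.

Lemma geodesic (x y : V) :
  exists p, [/\ path (adj G) x p, last x p = y & size p = dist G x y].
Proof.
have [p xp yE] := connectP (G_conn x y).
move: yE; case/shortenP: xp => q xq uq _ yE.
have ltqV : size q < #|V|.
  by rewrite -[(size q).+1]/(size (x :: q)) -(card_uniqP uq) max_card.
have has_q : has (has_path G x y) (iota 0 #|V|).
  apply/hasP; exists (size q); first by rewrite mem_iota.
  by apply/existsP; exists (in_tuple q); rewrite /= xq -yE eqxx.
have := nth_find 0 has_q; rewrite nth_iota; last first.
  by move: has_q; rewrite has_find size_iota.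
rewrite add0n => /existsP[r /and3P[xr /eqP rE _]].
by exists r; rewrite size_tuple.
Qed.

Lemma dist_triangle (x y z : V) : dist G x z <= dist G x y + dist G y z.
Proof.
have [p [xp yE <-]] := geodesic x y; have [q [yq zE <-]] := geodesic y z.
rewrite -size_cat; apply: dist_leq_walk; last by rewrite last_cat yE.
by rewrite cat_path xp yE.
Qed.

Lemma dist_adj (x y : V) : adj G x y -> dist G x y <= 1.
Proof. by move=> xy; apply: (@dist_leq_walk x y [:: y]); rewrite //= xy. Qed.

(** Distances to [y] strictly decrease along a geodesic, so a geodesic from a
vertex no farther from [y] than [w] cannot pass through [w]. *)
Lemma connect_avoiding (w u y : V) :
    u != w -> dist G u y <= dist G w y ->
  connect [rel a b | [&& adj G a b, a != w & b != w]] u y.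
Proof.
move=> uw le_uw; have [p [up yE szp]] := geodesic u y.
have wNp : w \notin p.
  apply/negP => /path.splitPr pE; case: pE up yE szp => p1 p2.
  rewrite cat_path last_cat /= size_cat => /and3P[_ _ wp2] yE szp.
  have := leq_trans le_uw (dist_leq_walk wp2 yE).
  by rewrite -szp /= addnS ltnNge leq_addl.
apply/connectP; exists p => //; elim: p u uw {le_uw szp yE} up wNp => //= a p IH u uw.
move=> /andP[ua ap]; rewrite inE negb_or eq_sym => /andP[aw wNp].
by rewrite ua uw aw IH.
Qed.

End Distance.

Section Tree.

Variables (V : finType) (G : sgraph V).
Hypothesis G_tree : is_tree G.

Let G_conn : forall x y : V, connect (adj G) x y := G_tree.1.2.

(** If neither of two neighbors of [w] were farther from [y] than [w], their
geodesics to [y] would join them outside [w], closing a cycle through [w]. *)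
Lemma interior_has_farther_neighbor (w y : V) :
  w \in interior G -> exists2 u, adj G w u & dist G w y < dist G u y.
Proof.
rewrite inE => /card_gt1P[u1 [u2 []]]; rewrite !inE => wu1 wu2 u12.
have [le1|] := leqP (dist G u1 y) (dist G w y); last by exists u1.
have [le2|] := leqP (dist G u2 y) (dist G w y); last by exists u2.
have neq_w u : adj G w u -> u != w.
  by apply: contraTneq => ->; rewrite adj_irrefl.
set e := [rel a b | [&& adj G a b, a != w & b != w]].
have e_sym : symmetric e.
  by move=> a b; rewrite /= adj_sym [(a != w) && _]andbC.
have : connect e u1 u2.
  apply: connect_trans (connect_avoiding G_conn (neq_w u1 wu1) le1) _.
  by rewrite (sym_connect_sym e_sym) connect_avoiding // neq_w.
case/connectP=> p0 e_p0 u2E; move: u2E; case/shortenP: e_p0 => p e_p up _ u2E.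
have wNp : w \notin u1 :: p.
  rewrite inE negb_or eq_sym neq_w //=.
  elim: p u1 e_p {up u2E u12 wu1 le1} => //= a p IH u /andP[/and3P[_ _ aw] ap].
  by rewrite inE negb_or eq_sym aw (IH a).
(* The path from [u1] to [u2] has at least one edge because [u1 != u2], so the
   cycle through [w] has length at least 3. *)
have := G_tree.2 [:: w, u1 & p]; rewrite /ucycle cons_uniq wNp up andbT.
case: p e_p {up wNp} u2E => [_ u2E|a p e_p u2E]; first by rewrite u2E eqxx in u12.
suff -> : cycle (adj G) [:: w, u1, a & p] by move/(_ isT).
have sub_e : subrel e (adj G) by move=> b c /and3P[].
rewrite (cycle_path w) /= -[last a p]u2E adj_sym wu2 wu1 /=.
exact: (sub_path sub_e e_p).
Qed.

Lemma farthest_is_end (w y : V) :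
  (forall u, adj G w u -> dist G u y <= dist G w y) -> w \notin interior G.
Proof.
move=> far; apply/negP => /(@interior_has_farther_neighbor w y)[u wu].
by rewrite ltnNge far.
Qed.

Lemma tree_has_end : exists v, v \notin interior G.
Proof.
have /card_gt0P[y _] := G_tree.1.1.
have [w _ w_max] := @arg_maxnP _ y predT (fun w => dist G w y) isT.
by exists w; apply: (@farthest_is_end w y) => u _; apply: w_max.
Qed.

(** Among the vertices behind [x] as seen from [y], one farthest from [y] is an
end: a neighbor farther from [y] would again be behind [x]. *)
Lemma end_behind (x y : V) :
  exists2 w, w \notin interior G & dist G w y = dist G w x + dist G x y.
Proof.
pose behind := [pred w | dist G w y == dist G w x + dist G x y].
have behind_x : behind x by rewrite /= dist_self.
have [w /eqP wE w_max] := @arg_maxnP _ x behind (fun w => dist G w y) behind_x.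
exists w => //; apply: (@farthest_is_end w y) => u wu.
rewrite leqNgt; apply/negP => lt_wu.
suff /w_max /(leq_trans lt_wu) : behind u by rewrite ltnn.
rewrite /= eqn_leq dist_triangle //=.
apply: leq_trans lt_wu; rewrite wE -addSn leq_add2r -add1n.
apply: leq_trans (dist_triangle G_conn u w x) _.
by rewrite leq_add2r dist_adj // adj_sym.
Qed.

Lemma metric_generator_ends (v : V) (S : {set V}) :
  ~: (v |: interior G) \subset S -> metric_generator G S.
Proof.
move=> sub_S; apply/forallP=> x; apply/forallP=> y; apply/implyP=> xy.
have [w1 end1 w1E] := end_behind x y; have [w2 end2 w2E] := end_behind y x.
have xy_gt0 := dist_gt0 G xy.
have yx_gt0 : 0 < dist G y x by rewrite dist_gt0 // eq_sym.
have lt1 : dist G w1 x < dist G w1 y by rewrite w1E -[X in X < _]addn0 ltn_add2l.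
have lt2 : dist G w2 y < dist G w2 x by rewrite w2E -[X in X < _]addn0 ltn_add2l.
have in_S w : w \notin interior G -> w != v -> w \in S.
  by move=> end_w wv; apply: (subsetP sub_S); rewrite in_setC in_setU1 negb_or wv.
apply/existsP; have [w1v|w1v] := eqVneq w1 v; last first.
  by exists w1; rewrite in_S //= /resolves neq_ltn lt1.
exists w2; rewrite /resolves neq_ltn lt2 orbT andbT in_S //.
apply/negP => /eqP w2v; move: lt1; rewrite w1v -w2v.
by rewrite ltnNge ltnW.
Qed.

End Tree.

Lemma Sd_min (V : finType) (k : nat) (G : 'I_k -> sgraph V) (S : {set V}) :
  sim_metric_generator G S -> Sd G <= #|S|.
Proof.
move=> genS; rewrite /Sd; case: arg_minnP => [|R _]; last exact.
exact: sim_metric_generatorT.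
Qed.

Theorem proposition5p2 (V : finType) (k : nat) (T : 'I_k -> sgraph V)
    (k_ge1 : 1 <= k)
    (T_tree : forall i : 'I_k, is_tree (T i))
    (T_not_path : forall i : 'I_k, ~ is_path_graph (T i)) :
  ((Sd T)%:Z <= #|V|%:Z - #|\bigcap_(i < k) interior (T i)|%:Z - 1)%R.
Proof.
set I := \bigcap_(i < k) interior (T i).
have [v v_end] := tree_has_end (T_tree (Ordinal k_ge1)).
have vNI : v \notin I.
  by apply: contra v_end => /bigcapP; apply.
have gen : sim_metric_generator T (~: (v |: I)).
  apply/forallP=> i; apply: (metric_generator_ends (T_tree i) (v := v)).
  by rewrite setCS setUS // bigcap_inf.
have := Sd_min gen; rewrite -(leq_add2l #|v |: I|) cardsC cardsU1 vNI add1n => le_V.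
rewrite lerBrDr lerBrDr -!PoszD lez_nat.
by rewrite -addnA add1n addnC.
Qed.
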